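(* For every instance of fair division with market values with two agents having monotone subjective utilities $u_1,u_2:2^{\mathcal{M}}\to\mathbb{R}_{\ge0}$ and with an additive market valuation $v:2^{\mathcal{M}}\to\mathbb{R}_{\ge0}$, there exists an allocation that is EF1 with respect to the subjective utilities and SD-EF1 with respect to the market valuation, and such an allocation can be computed using polynomially many value queries.
   Context: $\mathcal{M}$ is a finite set of $m$ indivisible goods. A function $f:2^{\mathcal{M}}\to\mathbb{R}_{\ge0}$ is monotone if $f(X)\le f(Y)$ whenever $X\subseteq Y\subseteq\mathcal{M}$, and additive if $f(S)=\sum_{g\in S}f(\{g\})$ for all $S\subseteq\mathcal{M}$, with $f(\emptyset)=0$; write $f(g)=f(\{g\})$. An allocation $A=(A_1,A_2)$ is a partition of $\mathcal{M}$ into two disjoint (possibly empty) bundles with union $\mathcal{M}$, $A_i$ being given to agent $i$. A value query to the subjective utilities asks for the utility $u_i(S)$ of an agent $i$ for a bundle $S\subseteq\mathcal{M}$. $A$ is EF1 with respect to the subjective utilities if for all agents $i,j$, either $A_j=\emptyset$ or $u_i(A_i)\ge u_i(A_j\setminus\{g\})$ for some $g\in A_j$. For $X,Y\subseteq\mathcal{M}$, write $X \succcurlyeq^{\mathsf{SD}}_{v} Y$ if for each $g\in\mathcal{M}$, $|\{g'\in X: v(g')\ge v(g)\}|\ge |\{g'\in Y: v(g')\ge v(g)\}|$. $A$ is SD-EF1 with respect to the market valuation if for all agents $i,j$, either $A_j=\emptyset$ or $A_i\succcurlyeq^{\mathsf{SD}}_{v} A_j\setminus\{g\}$ for some $g\in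 A_j$. *)

(* Defs.v *)
From HB Require Import structures.
From mathcomp Require Import all_boot all_order all_algebra.
From mathcomp Require Import reals.
Set Implicit Arguments.
Unset Strict Implicit.
Unset Printing Implicit Defensive.
Import Order.TTheory GRing.Theory Num.Theory.
Local Open Scope ring_scope.

Definition agent := 'I_2.

Section Valuations.
Variables (R : realType) (M : finType).
Implicit Types f : {set M} -> R.

Definition nonneg_valuation f := forall S : {set M}, 0 <= f S.

Definition monotone_valuation f :=
  forall X Y : {set M}, X \subset Y -> f X <= f Y.

Definition additive_valuation f :=
  f set0 = 0 /\ forall S : {set M}, f S = \sum_(g in S) f [set g].

(* Instances of fair division with market values: no condition relates u and
   v, and u i set0 is not required to be 0. *)
Record is_instance (u : agent -> {set M} -> R) (v : {set M} -> R) : Prop := {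
  subjective_nonneg : forall i, nonneg_valuation (u i);
  subjective_monotone : forall i, monotone_valuation (u i);
  market_nonneg : nonneg_valuation v;
  market_additive : additive_valuation v }.

End Valuations.

Section Fairness.
Variables (R : realType) (M : finType).

Definition is_allocation (A : agent -> {set M}) :=
  [disjoint A ord0 & A ord_max] /\ A ord0 :|: A ord_max = [set: M].

Definition EF1 (u : agent -> {set M} -> R) (A : agent -> {set M}) :=
  forall i j : agent, A j = set0 \/
    exists2 g, g \in A j & u i (A j :\ g) <= u i (A i).

Definition sd_pref (v : {set M} -> R) (X Y : {set M}) :=
  forall g : M,
    (#|[set g' in Y | (v [set g] <= v [set g'])%R]| <=
     #|[set g' in X | (v [set g] <= v [set g'])%R]|)%N.

Definition SD_EF1 (v : {set M} -> R) (A : agent -> {set M}) :=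
  forall i j : agent, A j = set0 \/
    exists2 g, g \in A j & sd_pref v (A i) (A j :\ g).

Definition fair_allocation (u : agent -> {set M} -> R) (v : {set M} -> R)
    (A : agent -> {set M}) :=
  [/\ is_allocation A, EF1 u A & SD_EF1 v A].

End Fairness.

(* Deterministic adaptive value-query algorithms, as decision trees: a node
   [Ask i X k] asks for the utility of agent i for the bundle X and goes on
   with k applied to the answer. Only queries are counted, and the utilities
   are accessible only through them. *)
Inductive query_tree (R : Type) (M : finType) (T : Type) : Type :=
| Return of T
| Ask of agent & {set M} & (R -> query_tree R M T).

Section Execution.
Variables (R : Type) (M : finType) (T : Type).

Fixpoint run (t : query_tree R M T) (u : agent -> {set M} -> R) : T :=
  match t with
  | Return x => x
  | Ask i X k => run (k (u i X)) u
  end.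

Fixpoint num_queries (t : query_tree R M T) (u : agent -> {set M} -> R) : nat :=
  match t with
  | Return _ => 0%N
  | Ask i X k => (num_queries (k (u i X)) u).+1
  end.

End Execution.

(* The set of goods and the market valuation are public input; the subjective
   utilities are not. *)
Definition query_algorithm (R : Type) :=
  forall M : finType, ({set M} -> R) -> query_tree R M (agent -> {set M}).

(* Main.v *)
Require Import Defs.
From HB Require Import structures.
From mathcomp Require Import all_boot all_order all_algebra.
From mathcomp Require Import reals.
From mathcomp Require Import zify.
Set Implicit Arguments.
Unset Strict Implicit.
Unset Printing Implicit Defensive.
Import Order.TTheory GRing.Theory Num.Theory.
Local Open Scope ring_scope.

(** Sort the goods by decreasing market value and pair consecutive ones. A
    partition that splits every pair is SD-EF1: up to any market value, a bundle
    has at most one good more than the other, and its best good is removed.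
    Starting from such a partition, exchange the goods of one pair after the
    other, until the two bundles are swapped. The preference of the first agent
    between them is reversed at some exchange, and monotonicity makes one of the
    two partitions around that exchange EF1 for this agent with either bundle;
    the second agent then chooses. The partitions depend only on the market
    valuation, so that it suffices to query the bundles of these O(m) partitions
    with at most one good removed. *)

(** * Cuts that are EF1 for one agent *)

Section Cut.
Variables (R : realType) (M : finType) (u : {set M} -> R).
Hypothesis u_mono : monotone_valuation u.
Implicit Types X Y Z : {set M}.

Definition no_envy1 X Y := Y = set0 \/ exists2 g, g \in Y & u (Y :\ g) <= u X.

Definition ef1_cut X := no_envy1 X (~: X) /\ no_envy1 (~: X) X.

Lemma ef1_cutC X : ef1_cut (~: X) -> ef1_cut X.
Proof. by rewrite /ef1_cut setCK => -[]. Qed.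

(** Remove the good of [Y] outside [Z], or any good of [Y] if there is none: what remains lies in
    [Z], and monotonicity applies. *)
Lemma no_envy1_near X Y Z : (#|Y :\: Z| <= 1)%N -> u Z <= u X -> no_envy1 X Y.
Proof.
move=> /card_le1_eqP YZ ZX.
have [->|[y yY]] := set_0Vmem Y; first by left.
right; have [YZ0|[g]] := set_0Vmem (Y :\: Z).
  exists y => //; apply: le_trans ZX; apply: u_mono.
  by apply: subset_trans (subD1set _ _) _; rewrite -setD_eq0 YZ0.
rewrite inE => /andP[gZ gY]; exists g => //; apply: le_trans ZX; apply: u_mono.
apply/subsetP => x /setD1P[xg xY]; apply/negPn/negP => xZ.
by move: xg; rewrite (YZ x g) ?inE ?xZ ?gZ ?eqxx.
Qed.

Lemma no_envy1_le X Y : u Y <= u X -> no_envy1 X Y.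
Proof. by apply: no_envy1_near; rewrite setDv cards0. Qed.

(** Compare the parts [X :&: X'] and [~: X :&: ~: X'] that the exchange leaves fixed. In each of [X]
    and [~: X'], at most one good lies outside the fixed part. If the first part is worth no more,
    [~: X] accepts [X] up to one good; otherwise [X'] accepts [~: X'] up to one good. *)
Lemma ef1_cut_exchange X X' : (#|X :\: X'| <= 1)%N ->
  u (~: X) <= u X -> u X' <= u (~: X') -> ef1_cut X \/ ef1_cut X'.
Proof.
move=> XX' uX uX'.
have [le_u|/ltW le_u] := lerP (u (X :&: X')) (u (~: X :&: ~: X')).
- left; split; first exact: no_envy1_le.
  apply: (@no_envy1_near _ _ (X :&: X')).
    by rewrite setDIr setDv set0U.
  by apply: le_trans le_u _; apply: u_mono; exact: subsetIl.
- right; split; last exact: no_envy1_le.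
  apply: (@no_envy1_near _ _ (~: X :&: ~: X')).
    by rewrite setDIr setDv setU0 !setDE setCK setIC -setDE.
  by apply: le_trans le_u _; apply: u_mono; exact: subsetIr.
Qed.

Lemma exists_ef1_cut (X : nat -> {set M}) (m : nat) :
  (forall t, (#|X t :\: X t.+1| <= 1)%N) ->
  (forall t, (#|X t.+1 :\: X t| <= 1)%N) ->
  X m = ~: X 0%N ->
  exists2 t, (t <= m)%N & ef1_cut (X t).
Proof.
wlog le0 : X / u (~: X 0%N) <= u (X 0%N).
  move=> wl stepl stepr Xm.
  have [le0|/ltW le0] := lerP (u (~: X 0%N)) (u (X 0%N)); first exact: wl.
  have setDCC Y Z : ~: Y :\: ~: Z = Z :\: Y by rewrite !setDE setCK setIC.
  (* Complementing the whole sequence reverses the initial preference and interchanges the two step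
     bounds. *)
  have [||||t tm /ef1_cutC] := wl (fun t => ~: X t); last by exists t.
  - by rewrite setCK.
  - by move=> t; rewrite setDCC.
  - by move=> t; rewrite setDCC.
  - by rewrite Xm.
move=> stepl _ Xm.
have ex_rev : exists t, u (X t) <= u (~: X t).
  by exists m; rewrite Xm setCK.
(* Take the first reversal; at index 0 it means that both bundles have equal utility. *)
case: (ex_minnP ex_rev) => -[|t] rev t_min.
  by exists 0%N => //; split; apply: no_envy1_le.
have tm : (t.+1 <= m)%N by apply: t_min; rewrite Xm setCK.
have le_t : u (~: X t) <= u (X t).
  by rewrite leNgt; apply/negP => /ltW /t_min; rewrite ltnn.
have [cut|cut] := ef1_cut_exchange (stepl t) le_t rev.
- by exists t => //; exact: ltnW.
- by exists t.+1.
Qed.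

End Cut.

(** * Counting one rank per pair *)

Lemma sum_odd_addb_double (b : nat -> bool) (n : nat) :
  (\sum_(0 <= i < n.*2) (odd i (+) b i./2) = n)%N.
Proof.
elim: n => [|n IHn]; first by rewrite big_geq.
rewrite doubleS !big_nat_recr //= IHn odd_double uphalf_double half_double.
by case: (b n); rewrite /= !(addn0, addn1).
Qed.

(** Each complete pair contributes exactly 1, and a last incomplete pair is dropped. *)
Lemma sum_odd_addb_ge (b : nat -> bool) (n : nat) :
  (n./2 <= \sum_(0 <= i < n) (odd i (+) b i./2))%N.
Proof.
rewrite -[X in (X <= _)%N](sum_odd_addb_double b).
have le_n : (n./2.*2 <= n)%N by lia.
by rewrite [X in (_ <= X)%N](big_cat_nat (n := n./2.*2)) //= leq_addr.
Qed.

(** * Ranking by market value and SD-EF1 of balanced bundles *)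

Section Market.
Variables (R : realType) (M : finType) (v : {set M} -> R).

Definition ranking : seq M :=
  sort (fun x y => v [set y] <= v [set x]) (enum M).

Definition rank (g : M) : nat := index g ranking.

(* The goods of ranks 2k and 2k+1 form the k-th pair, with a missing partner in
   the last pair when #|M| is odd; the first t pairs have been exchanged. *)
Definition swapped (t : nat) : {set M} :=
  [set g | odd (rank g) (+) ((rank g)./2 < t)%N].

Lemma mem_ranking g : g \in ranking.
Proof. by rewrite mem_sort mem_enum. Qed.

Lemma size_ranking : size ranking = #|M|.
Proof. by rewrite size_sort cardE. Qed.

Lemma uniq_ranking : uniq ranking.
Proof. by rewrite sort_uniq enum_uniq. Qed.

Lemma rank_lt g : (rank g < #|M|)%N.
Proof. by rewrite -size_ranking index_mem mem_ranking. Qed.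

Lemma rank_inj : injective rank.
Proof. by move=> x y; apply: index_inj (mem_ranking x) (mem_ranking y). Qed.

Lemma rank_value x y : (rank x <= rank y)%N -> v [set y] <= v [set x].
Proof.
move=> le_xy.
have tr : transitive (fun x y : M => v [set y] <= v [set x]).
  by move=> b a c ba cb; exact: le_trans cb ba.
have srt : sorted (fun x y => v [set y] <= v [set x]) ranking.
  by apply: sort_sorted => a b; exact: le_total.
have /= := sorted_leq_nth tr (fun x => lexx (v [set x])) x srt (rank x) (rank y).
rewrite !inE !size_ranking !rank_lt !nth_index ?mem_ranking //.
by apply.
Qed.

(** Values decrease along the ranking, so [n] is the position of the first good worth less than [g].
    SD comparisons thus become counts in prefixes. *)
Lemma upper_prefix g : exists n, (n <= #|M|)%N /\
  forall x, (v [set g] <= v [set x]) = (rank x < n)%N.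
Proof.
pose n := find (fun x => ~~ (v [set g] <= v [set x])) ranking.
have n_le : (n <= #|M|)%N by rewrite -size_ranking find_size.
exists n; split=> // x; apply/idP/idP => [gx|/(before_find x)]; last first.
  by rewrite nth_index ?mem_ranking // => /negbFE.
rewrite ltnNge; apply/negP => nx.
have hasN : has (fun x => ~~ (v [set g] <= v [set x])) ranking.
  by rewrite has_find size_ranking; exact: leq_ltn_trans nx (rank_lt x).
move: (nth_find x hasN) => /negP; apply; apply: le_trans gx _; apply: rank_value.
by rewrite /rank index_uniq ?uniq_ranking // -has_find.
Qed.

Definition prefix n := [set g | (rank g < n)%N].

Lemma card_prefix (c : nat -> bool) (n : nat) : (n <= #|M|)%N ->
  #|[set g | c (rank g)] :&: prefix n| = (\sum_(0 <= i < n) c i)%N.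
Proof.
move=> nM; rewrite -sum1_card.
have h_bij : bijective (fun g => Ordinal (rank_lt g)).
  by apply: inj_card_bij; rewrite ?card_ord // => x y [] /rank_inj.
rewrite big_mkord [RHS](eq_bigr (fun i : 'I_n => if c i then 1 else 0)%N).
  rewrite -big_mkcond (big_ord_widen_cond _ _ (fun=> 1%N) nM).
  rewrite [RHS](reindex _ (onW_bij _ h_bij)) /=.
  by apply: eq_bigl => g; rewrite !inE.
by move=> i _; case: (c i).
Qed.

(** The bit [b k] selects from the k-th pair: the even rank if true, the odd rank if false. *)
Definition balanced (X : {set M}) := exists b : nat -> bool,
  X = [set g | odd (rank g) (+) b (rank g)./2].

Lemma balanced_swapped t : balanced (swapped t).
Proof. by exists (fun i => i < t)%N. Qed.

Lemma balancedC X : balanced X -> balanced (~: X).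
Proof.
case=> b ->; exists (fun i => ~~ b i).
by apply/setP => g; rewrite !inE addbN.
Qed.

Lemma card_balanced_prefix_ge X n : balanced X -> (n <= #|M|)%N ->
  (n./2 <= #|X :&: prefix n|)%N.
Proof.
case=> b -> nM; rewrite (card_prefix (fun i => odd i (+) b i./2)) //.
exact: sum_odd_addb_ge.
Qed.

Lemma card_prefix_setC X n : (n <= #|M|)%N ->
  (#|X :&: prefix n| + #|~: X :&: prefix n| = n)%N.
Proof.
move=> nM; have := card_prefix (fun => true) nM.
rewrite sum_nat_const_nat subn0 muln1 => {3}<-.
rewrite [~: X :&: _]setIC -setDE [X :&: _]setIC cardsID.
by apply: eq_card => g; rewrite !inE.
Qed.

(** In a prefix of length [n] the complement has at least [n./2] goods, so [X] has at most one more.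
    Removing the good of [X] of least rank lowers the count in every prefix that meets [X]. *)
Lemma balanced_sd_pref X : balanced X ->
  X = set0 \/ exists2 g, g \in X & sd_pref v (~: X) (X :\ g).
Proof.
move=> balX; have [->|[x xX]] := set_0Vmem X; first by left.
have [g gX g_min] : exists2 g, g \in X & forall y, y \in X -> (rank g <= rank y)%N.
  by case: (arg_minnP rank xX) => g; exists g.
right; exists g => // h; have [n [nM upper]] := upper_prefix h.
have upperE (Y : {set M}) : [set g' in Y | v [set h] <= v [set g']] = Y :&: prefix n.
  by apply/setP => y; rewrite !inE upper.
rewrite !upperE setIDAC.
have leC := card_balanced_prefix_ge (balancedC balX) nM.
have leX := card_prefix_setC X nM.
have [->|[y]] := set_0Vmem (X :&: prefix n); first by rewrite set0D cards0.
rewrite !inE => /andP[yX yn].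
have gn : g \in X :&: prefix n by rewrite !inE gX (leq_ltn_trans (g_min y yX)).
have := cardsD1 g (X :&: prefix n); rewrite gn.
lia.
Qed.

Lemma swapped_step t :
  (#|swapped t :\: swapped t.+1| <= 1)%N /\
  (#|swapped t.+1 :\: swapped t| <= 1)%N.
Proof.
(* The only possible elements are the goods of rank [2t+1] and [2t], respectively. *)
by split; apply/card_le1_eqP => x y; rewrite !inE => xP yP; apply: rank_inj; lia.
Qed.

Lemma swapped_last : swapped #|M| = ~: swapped 0.
Proof.
apply/setP => g; have := rank_lt g; rewrite !inE.
lia.
Qed.

End Market.

(** * Asking a fixed list of queries *)

Section Queries.
Variables (R : realType) (M : finType) (T : Type).
Implicit Types (u w : agent -> {set M} -> R) (qs : seq (agent * {set M})).

(** The answers reach [k] as a total function, with default 0 off the list. *)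
Fixpoint ask_all qs (k : (agent -> {set M} -> R) -> T) : query_tree R M T :=
  match qs with
  | [::] => Return R M (k (fun _ _ => 0))
  | q :: qs' => Ask q.1 q.2 (fun r =>
      ask_all qs' (fun w => k (fun i X => if (i, X) == q then r else w i X)))
  end.

Lemma num_queries_ask_all qs k u : num_queries (ask_all qs k) u = size qs.
Proof. by elim: qs k => //= q qs IHqs k; rewrite IHqs. Qed.

Lemma run_ask_all qs k u : exists w,
  (forall i X, (i, X) \in qs -> w i X = u i X) /\ run (ask_all qs k) u = k w.
Proof.
elim: qs k => [|[j Y] qs IHqs] k /=; first by exists (fun _ _ => 0).
have [w [wu ->]] := IHqs (fun w => k (fun i X =>
  if (i, X) == (j, Y) then u j Y else w i X)).
exists (fun i X => if (i, X) == (j, Y) then u j Y else w i X); split=> // i X.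
by rewrite inE; have [[-> ->]|_ /wu] := eqVneq.
Qed.

End Queries.

(** * Candidate allocations and the queries that decide them *)

Section Algorithm.
Variables (R : realType) (M : finType).
Implicit Types (u w : agent -> {set M} -> R) (v : {set M} -> R).

Definition give (X : {set M}) : agent -> {set M} :=
  fun i => if i == ord0 then X else ~: X.

Lemma agentP (i : agent) : i = ord0 \/ i = ord_max.
Proof. by case: i => -[|[]] // p; [left|right]; apply: val_inj. Qed.

Lemma give_allocation X : is_allocation (give X).
Proof. by split; rewrite ?setUCr // -setI_eq0 setICr. Qed.

Lemma give_SD_EF1 v X : balanced v X -> SD_EF1 v (give X).
Proof.
move=> balX i j.
have [->|[g gj sd]] : give X j = set0 \/
    exists2 g, g \in give X j & sd_pref v (~: give X j) (give X j :\ g).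
  apply: balanced_sd_pref; rewrite /give; case: ifP => // _; exact: balancedC.
  by left.
right; exists g => // h; have [->|ij] := eqVneq i j.
  by apply/subset_leq_card/subsetP => x; rewrite !inE => /andP[/andP[_ ->]].
suff -> : give X i = ~: give X j by [].
by move: ij; case: (agentP i) => ->; case: (agentP j) => ->; rewrite // /give /= setCK.
Qed.

Lemma give_EF1 u X : (forall i, monotone_valuation (u i)) ->
  no_envy1 (u ord0) X (~: X) -> no_envy1 (u ord_max) (~: X) X -> EF1 u (give X).
Proof.
move=> u_mono ne0 ne1 i j.
case: (agentP i) => ->; case: (agentP j) => -> //=; exact: no_envy1_le.
Qed.

Definition EF1b w (A : agent -> {set M}) : bool :=
  [forall i, forall j, (A j == set0) ||
    [exists g, (g \in A j) && (w i (A j :\ g) <= w i (A i))]].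

Lemma EF1P w A : reflect (EF1 w A) (EF1b w A).
Proof.
apply: (iffP forallP) => [ef i j|ef i].
  have /forallP/(_ j)/orP[/eqP|/existsP[g /andP[]]] := ef i; first by left.
  by right; exists g.
apply/forallP => j; apply/orP; have [->|[g gj le_g]] := ef i j; first by left.
by right; apply/existsP; exists g; rewrite gj.
Qed.

(** Complements are included because the second agent may choose either side of a cut. *)
Definition bundles v : seq {set M} :=
  let s := [seq swapped v t | t <- iota 0 #|M|.+1] in s ++ [seq ~: X | X <- s].

Lemma bundlesC v X : X \in bundles v -> ~: X \in bundles v.
Proof.
rewrite !mem_cat => /orP[Xs|/mapP[Y Ys ->]].
  by rewrite map_f ?orbT.
by rewrite setCK Ys.
Qed.

Lemma balanced_bundles v X : X \in bundles v -> balanced v X.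
Proof.
rewrite mem_cat => /orP[/mapP[t _ ->]|/mapP[_ /mapP[t _ ->] ->]].
  exact: balanced_swapped.
exact/balancedC/balanced_swapped.
Qed.

Lemma exists_EF1_bundle u v : (forall i, monotone_valuation (u i)) ->
  exists2 X, X \in bundles v & EF1 u (give X).
Proof.
move=> u_mono.
have [t tM [cut cutC]] := exists_ef1_cut (u_mono ord0)
  (fun t => (swapped_step v t).1) (fun t => (swapped_step v t).2) (swapped_last v).
have tb : swapped v t \in bundles v.
  by rewrite mem_cat map_f // mem_iota.
have [le1|/ltW le1] := lerP (u ord_max (swapped v t)) (u ord_max (~: swapped v t)).
  by exists (swapped v t) => //; apply: give_EF1 => //; exact: no_envy1_le.
exists (~: swapped v t); first exact: bundlesC.
by apply: give_EF1; rewrite ?setCK //; exact: no_envy1_le.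
Qed.

(** [Z = set0] yields the bundle itself, and a singleton [Z] the bundle with a good removed: EF1 of
    a candidate depends on no other values. *)
Definition queries v : seq (agent * {set M}) :=
  [seq (i, Y) | i <- enum 'I_2,
    Y <- [seq X :\: Z | X <- bundles v, Z <- set0 :: [seq [set g] | g <- enum M]]].

(** There are 2 agents, [2 * #|M|.+1] bundles and [#|M|.+1] choices of [Z]. *)
Lemma size_queries v : size (queries v) = (4 * #|M|.+1 ^ 2)%N.
Proof.
rewrite !size_allpairs size_cat [size (_ :: _)]/= !size_map size_iota.
rewrite -!enumT -!cardE card_ord.
by rewrite addnn -mul2n -mulnn !mulnA.
Qed.

Lemma EF1b_queries u w v X :
  (forall i Y, (i, Y) \in queries v -> w i Y = u i Y) -> X \in bundles v ->
  EF1b w (give X) = EF1b u (give X).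
Proof.
move=> wu Xb.
have gb i : give X i \in bundles v.
  by rewrite /give; case: ifP => // _; exact: bundlesC.
have wuD i j Z : Z \in set0 :: [seq [set g] | g <- enum M] ->
    w i (give X j :\: Z) = u i (give X j :\: Z).
  move=> Zs; apply: wu; apply: allpairs_f; first by rewrite mem_enum.
  exact: allpairs_f.
apply: eq_forallb => i; apply: eq_forallb => j; congr orb.
apply: eq_existsb => g; congr (_ && (_ <= _)).
  by apply: wuD; rewrite inE map_f ?orbT // mem_enum.
by have := wuD i i set0; rewrite setD0; apply; rewrite mem_head.
Qed.

End Algorithm.

(** * The algorithm and its query bound *)

Definition market_algorithm (R : realType) : query_algorithm R := fun M v =>
  ask_all (queries v) (fun w =>
    give (nth set0 (bundles v) (find (fun X => EF1b w (give X)) (bundles v)))).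

Lemma market_algorithm_fair (R : realType) (M : finType)
    (u : agent -> {set M} -> R) (v : {set M} -> R) :
  is_instance u v -> fair_allocation u v (run (market_algorithm v) u).
Proof.
case=> _ u_mono _ _; rewrite /market_algorithm.
have [w [wu ->]] := run_ask_all (queries v) (fun w =>
  give (nth set0 (bundles v) (find (fun X => EF1b w (give X)) (bundles v)))) u.
(* Some candidate is EF1 for [u], hence passes the test on the answers [w]; so [find] succeeds and
   the default of [nth] is not reached. *)
have hasX : has (fun X => EF1b w (give X)) (bundles v).
  have [X Xb /EF1P efX] := exists_EF1_bundle v u_mono.
  by apply/hasP; exists X => //; rewrite (EF1b_queries wu).
set X := nth _ _ _.
have Xb : X \in bundles v by rewrite mem_nth // -has_find.
split; first exact: give_allocation.
  by apply/EF1P; rewrite -(EF1b_queries wu) //; exact: nth_find hasX.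
exact/give_SD_EF1/balanced_bundles.
Qed.

Theorem theorem9 (R : realType) :
  (forall (M : finType) (u : agent -> {set M} -> R) (v : {set M} -> R),
     is_instance u v -> exists A : agent -> {set M}, fair_allocation u v A)
  /\
  (exists (alg : query_algorithm R) (p : {poly nat}),
     forall (M : finType) (u : agent -> {set M} -> R) (v : {set M} -> R),
       is_instance u v ->
       fair_allocation u v (run (alg M v) u) /\
       (num_queries (alg M v) u <= p.[#|M|])%N).
Proof.
split=> [M u v inst|].
  by exists (run (market_algorithm v) u); exact: market_algorithm_fair.
exists (@market_algorithm R), (4%:P * ('X + 1) ^+ 2) => M u v inst.
split; first exact: market_algorithm_fair.
rewrite num_queries_ask_all size_queries hornerM hornerC expr2 hornerM.
rewrite hornerD hornerX hornerC -mulnn -[#|M|.+1]addn1; exact: leqnn.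
Qed.
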